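(* There exist a Hermitian manifold $(X,\omega)$, a holomorphic vector bundle $E\to X$, and a smooth Hermitian metric $h$ on $E$ such that $(E,h)$ is positively curved in the sense of weak Ohsawa-Takegoshi but $(E,h)$ is not Nakano semi-positive.
   Context: Multiple $L^2$-extension property of $(E,h)$ on an open set $U\subset X$: there are constants $C_m>0$ ($m\ge1$) with $\lim_{m\to\infty}\frac1m\log C_m=0$ such that for every $z\in U$, every nonzero $a\in E_z$ with $|a|_h<+\infty$, and every integer $m\ge1$ there is a holomorphic section $f_m\in H^0(U,E^{\otimes m})$ with $f_m(z)=a^{\otimes m}$ and $$\int_U|f_m|^2_{h^{\otimes m}}\,dV_\omega\le C_m|a^{\otimes m}|^2_{h^{\otimes m}}=C_m|a|_h^{2m}.$$ The constants $C_m$ do not depend on $z$ or $a$; $dV_\omega$ is the volume form of $\omega$. $(E,h)$ is positively curved in the sense of weak Ohsawa-Takegoshi if every $x\in X$ has an open neighborhood $U$ on which $(E,h)$ has the multiple $L^2$-extension property. Nakano semi-positivity of a smooth Hermitian metric: if $\Theta_h=\sum_{j,k}\Theta_{j\bar k}\,dz_j\wedge d\bar z_k$ is the Chern curvature in local coordinates, then $\sum_{j,k}(\Theta_{j\bar k}s_j,s_k)_h\ge0$ at every point $x$ for all $s_1,\dots,s_n\in E_x$, $n=\dim X$. *)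

(* Defs.v *)
From HB Require Import structures.
From mathcomp Require Import all_boot all_order all_algebra sesquilinear.
From mathcomp Require Import complex.
From mathcomp Require Import all_classical all_reals all_analysis.

Set Implicit Arguments.
Unset Strict Implicit.
Unset Printing Implicit Defensive.

Import Order.TTheory GRing.Theory Num.Theory numFieldNormedType.Exports.

Local Open Scope ring_scope.
Local Open Scope classical_set_scope.
Local Open Scope complex_scope.

(* The regular module [R[i]^o] is the copy of the complex numbers that carries
   the topology, the norm and the vector space structure over [R[i]]. *)
Notation Cplx R := (R[i]^o).

Notation innerProduct R V := {dot V for (@Num.conj (Cplx R))}.

Section CoordinateCalculus.
Variables (R : realType) (n : nat).
Local Notation C := (Cplx R).
Implicit Types (f : 'rV[C]_n -> C) (z v : 'rV[C]_n) (O : set 'rV[C]_n).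

(* The library differentiates along the scalar field, here the complex numbers;
   smoothness and the operators d/dz_j, d/dzbar_j need real derivatives, which
   are taken on real and imaginary parts. *)
Definition rderivable f v z :=
  derivable (fun t : R => complex.Re (f (z + t%:C *: v))) 0 1 /\
  derivable (fun t : R => complex.Im (f (z + t%:C *: v))) 0 1.

Definition rderive f v z : C :=
  (fun t : R => complex.Re (f (z + t%:C *: v)))^`() 0 +i*
  (fun t : R => complex.Im (f (z + t%:C *: v)))^`() 0.

Fixpoint Ck_on (k : nat) O f : Prop :=
  (forall z, O z -> {for z, continuous f}) /\
  if k is k'.+1 then
    forall v, (forall z, O z -> rderivable f v z) /\ Ck_on k' O (rderive f v)
  else True.

Definition smooth_on O f := forall k, Ck_on k O f.

Definition dz (j : 'I_n) f z : C :=
  (rderive f (delta_mx 0 j) z -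
   (0 +i* 1) * rderive f ((0 +i* 1) *: delta_mx 0 j) z) / 2%:R.

Definition dzbar (j : 'I_n) f z : C :=
  (rderive f (delta_mx 0 j) z +
   (0 +i* 1) * rderive f ((0 +i* 1) *: delta_mx 0 j) z) / 2%:R.

Definition dz_mx r (j : 'I_n) (F : 'rV[C]_n -> 'M[C]_r) z : 'M[C]_r :=
  \matrix_(a, b) dz j (fun w => F w a b) z.

Definition dzbar_mx r (j : 'I_n) (F : 'rV[C]_n -> 'M[C]_r) z : 'M[C]_r :=
  \matrix_(a, b) dzbar j (fun w => F w a b) z.

End CoordinateCalculus.

(* Integral with respect to the Lebesgue measure of C^n = R^2n, as an iterated
   integral over z_1 = x + iy, z_2, and so on; by Tonelli's theorem this is the
   integral against the product measure for nonnegative Borel functions. *)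
Fixpoint lebesgueC_integral (R : realType) (n : nat) :
    ('rV[Cplx R]_n -> \bar R) -> \bar R :=
  match n return ('rV[Cplx R]_n -> \bar R) -> \bar R with
  | 0%N => fun F => F 0
  | n'.+1 => fun F =>
      (\int[@lebesgue_measure R]_x \int[@lebesgue_measure R]_y
        lebesgueC_integral (fun w : 'rV[Cplx R]_n' =>
          F (row_mx (const_mx (x +i* y) : 'rV[Cplx R]_1) w)))%E
  end.

(* [cinv i] is the inverse of the chart [cmap i : cdom i -> C^n]; the values of
   both maps outside [cdom i] and [cmap i @` cdom i] are irrelevant. Base points
   are only there because the library's measurable spaces are pointed. *)
Record complexManifold (R : realType) (n : nat) := ComplexManifold {
  points :> ptopologicalType ;
  points_hausdorff : hausdorff_space points ;
  points_second_countable : @second_countable points ;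
  chart : Type ;
  cdom : chart -> set points ;
  cmap : chart -> points -> 'rV[Cplx R]_n ;
  cinv : chart -> 'rV[Cplx R]_n -> points ;
  cdom_open : forall i, open (cdom i) ;
  cdom_cover : forall x, exists i, cdom i x ;
  cimg_open : forall i, open (cmap i @` cdom i) ;
  cmapK : forall i x, cdom i x -> cinv i (cmap i x) = x ;
  cmap_continuous : forall i x, cdom i x -> {for x, continuous (cmap i)} ;
  cinv_continuous : forall i x, cdom i x ->
    {for cmap i x, continuous (cinv i)} ;
  transition_holomorphic : forall i j x, cdom i x -> cdom j x ->
    differentiable (cmap j \o cinv i) (cmap i x) }.

Section FunctionsOnManifolds.
Variables (R : realType) (n : nat) (X : complexManifold R n).
Local Notation C := (Cplx R).

Definition holomorphic_onM (U : set X) (f : X -> C) :=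
  forall (i : chart X) x, U x -> cdom i x ->
    differentiable (f \o @cinv R n X i) (cmap i x).

Definition smooth_onM (U : set X) (f : X -> C) :=
  forall i : chart X, smooth_on (cmap i @` (U `&` cdom i)) (f \o @cinv R n X i).

End FunctionsOnManifolds.

(* [omega i x] is the metric on T_x X read in the chart [i], i.e.
   omega = i \sum_(j, k) omega_jk dz_j /\ dzbar_k with
   omega_jk = omega i x (d/dz_j) (d/dz_k). The volume form is
   omega^n / n! = 2^n det(omega_jk) dlambda in these coordinates; this
   determines the Borel measure [vol], X being second countable. *)
Record hermitianManifold (R : realType) (n : nat) := HermitianManifold {
  manifold :> complexManifold R n ;
  omega : chart manifold -> manifold -> innerProduct R 'rV[Cplx R]_n ;
  omega_transition : forall i j x, cdom i x -> cdom j x -> forall u v,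
    omega i x u v =
    omega j x ('d (cmap j \o @cinv R n manifold i) (cmap i x) u)
              ('d (cmap j \o @cinv R n manifold i) (cmap i x) v) ;
  omega_smooth : forall i u v, smooth_onM (cdom i) (fun x => omega i x u v) ;
  vol : {measure set (g_sigma_algebraType (@open manifold)) -> \bar R} ;
  volE : forall (i : chart manifold)
      (A : set (g_sigma_algebraType (@open manifold))),
    measurable A -> A `<=` cdom i ->
    vol A = lebesgueC_integral (fun z =>
      (\1_(cmap i @` A) z * (2%:R ^+ n * complex.Re (\det (\matrix_(j, k)
        omega i (cinv i z) (delta_mx 0 j) (delta_mx 0 k)))))%:E) }.

(* A holomorphic vector bundle of rank r, given by its fibers and a cover by
   local frames whose transition matrices are holomorphic. *)
Record holBundle (R : realType) (n : nat) (X : complexManifold R n) (r : nat) :=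
  HolBundle {
  fiber :> X -> vectType (Cplx R) ;
  trivialization : Type ;
  tdom : trivialization -> set X ;
  frame : trivialization -> forall x, r.-tuple (fiber x) ;
  tdom_open : forall s, open (tdom s) ;
  tdom_cover : forall x, exists s, tdom s x ;
  frame_basis : forall s x, tdom s x -> basis_of fullv (frame s x) ;
  frame_transition : forall s t (a b : 'I_r),
    holomorphic_onM (tdom s `&` tdom t)
      (fun x => coord (frame s x) a (tnth (frame t x) b)) }.

Record hermitianMetric (R : realType) (n : nat) (X : complexManifold R n)
    (r : nat) (E : holBundle X r) := HermitianMetric {
  hdot :> forall x, innerProduct R (E x) ;
  hdot_smooth : forall (s : trivialization E) (a b : 'I_r),
    smooth_onM (tdom s)
      (fun x => hdot x (tnth (frame s x) a) (tnth (frame s x) b)) }.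

Section TensorPower.
Variables (R : realType) (V : vectType (Cplx R)).
Local Notation C := (Cplx R).

(* The tensor power of a finite dimensional space is realized as the space of
   multilinear forms on its dual. *)
Definition multilinear m (T : ('I_m -> 'Hom(V, C)) -> C) :=
  forall (k : 'I_m) (xi : 'I_m -> 'Hom(V, C)),
    scalar (fun phi => T [eta xi with k |-> phi]).

Record tensorPower (m : nat) := TensorPower {
  tensor_form :> ('I_m -> 'Hom(V, C)) -> C ;
  tensor_multilinear : multilinear tensor_form }.

Lemma pure_power_multilinear m (a : V) :
  multilinear (fun xi : 'I_m -> 'Hom(V, C) => \prod_k xi k a).
Proof.
move=> k xi c phi psi /=.
have E theta : \prod_i [eta xi with k |-> theta] i a =
    theta a * \prod_(i | i != k) xi i a.
  rewrite (bigD1 k) //= eqxx; congr (_ * _).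
  by apply: eq_bigr => i /negbTE ->.
by rewrite !E lfunE /= lfunE /= mulrDl mulrA.
Qed.

Definition pure_power m (a : V) : tensorPower m :=
  TensorPower (@pure_power_multilinear m a).

Definition tensor_coord r (e : r.-tuple V) m (T : tensorPower m)
    (J : {ffun 'I_m -> 'I_r}) : C :=
  T (fun k => linfun (coord e (J k))).

Definition norm2 (h : innerProduct R V) (a : V) : R := complex.Re (h a a).

(* The squared norm for the inner product induced on the tensor power, in which
   <a_1 (x) .. (x) a_m, b_1 (x) .. (x) b_m> = \prod_k h a_k b_k. It does not
   depend on the basis in which it is expanded. *)
Definition tensor_norm2 (h : innerProduct R V) m (T : tensorPower m) : R :=
  let e := vbasis {:V} in
  complex.Re (\sum_(I : {ffun 'I_m -> 'I_(\dim {:V})})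
    \sum_(J : {ffun 'I_m -> 'I_(\dim {:V})})
      tensor_coord e T I * (tensor_coord e T J)^* *
      \prod_k h (tnth e (I k)) (tnth e (J k))).

End TensorPower.

Section Positivity.
Variables (R : realType) (n : nat) (X : hermitianManifold R n) (r : nat).
Variables (E : holBundle X r) (h : hermitianMetric E).
Local Notation C := (Cplx R).

(* [f] is a section of the m-th tensor power of E, holomorphic on U; its values
   outside U are irrelevant. *)
Definition holomorphic_section (U : set X) m
    (f : forall x, tensorPower (E x) m) :=
  forall (s : trivialization E) (J : {ffun 'I_m -> 'I_r}),
    holomorphic_onM (U `&` tdom s)
      (fun x => tensor_coord (frame s x) (f x) J).

(* The finiteness of the norm is automatic for the smooth metrics considered
   here. *)
Definition multiple_L2_extension (U : set X) :=
  exists c : nat -> R,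
    [/\ forall m, (0 < m)%N -> 0 < c m,
        (fun m => ln (c m) / m%:R) @ \oo --> (0 : R) &
        forall z, U z -> forall a : E z, a != 0 ->
          ((Num.sqrt (norm2 (h z) a))%:E < +oo)%E ->
        forall m, (0 < m)%N ->
        exists f : forall x, tensorPower (E x) m,
          [/\ holomorphic_section U f,
              f z = pure_power m a &
              (\int[@vol R n X]_(x in (U : set (g_sigma_algebraType (@open X))))
                 (tensor_norm2 (h x) (f x))%:E <=
               (c m * tensor_norm2 (h z) (pure_power m a))%:E)%E]].

Definition weak_Ohsawa_Takegoshi :=
  forall x : X, exists U : set X,
    [/\ open U, U x & multiple_L2_extension U].

Definition gram (i : chart X) (s : trivialization E) (z : 'rV[C]_n) : 'M[C]_r :=
  \matrix_(a, b) h (cinv i z) (tnth (frame s (cinv i z)) a)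
                              (tnth (frame s (cinv i z)) b).

(* In a holomorphic frame e with Gram matrix H_ab = h(e_a, e_b), the Chern
   connection D e_a = \sum_b theta_ab e_b has theta = (dH) H^-1, d being the
   (1,0)-derivative, and the curvature is dbar theta, so the coefficient of
   dz_j /\ dzbar_k is - (d/dzbar_k) ((d/dz_j H) H^-1). *)
Definition chern_curvature_mx (i : chart X) (s : trivialization E)
    (j k : 'I_n) (z : 'rV[C]_n) : 'M[C]_r :=
  - dzbar_mx k (fun w => dz_mx j (gram i s) w *m invmx (gram i s w)) z.

Definition chern_curvature (i : chart X) (s : trivialization E)
    (j k : 'I_n) (x : X) (v : E x) : E x :=
  \sum_a \sum_b (coord (frame s x) a v *
    chern_curvature_mx i s j k (cmap i x) a b) *: tnth (frame s x) b.

Definition Nakano_semipositive :=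
  forall (i : chart X) (s : trivialization E) (x : X), cdom i x -> tdom s x ->
  forall v : 'I_n -> E x,
    0 <= \sum_j \sum_k h x (chern_curvature i s j k (v j)) (v k).

End Positivity.

(* Main.v *)
(* On C^2 take the quotient E of the trivial Hermitian bundle C^3 by the line
   spanned by (1, w_0, w_1), with the quotient metric. Framed by the images of
   the last two basis vectors it has Gram matrix
   H_ab = delta_ab - conj(w_a) w_b / (1 + |w|^2).
   A vector a of E_z is the image of a vector of C^3 of the same norm, and the
   image F of this constant vector is a holomorphic section with F(z) = a and
   |F(w)| <= |a| for all w. Hence the m-th tensor powers of F have the extension
   property on a polydisc U with one constant C_m = vol(U) + 1 for all m.
   On the other hand H^-1 = 1 + (conj(w_a) w_b), so that (dH/dw_j) H^-1 has
   entries - conj(w_a) delta_bj / (1 + |w|^2), and the Nakano form at 0 is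
   \sum_jk (s_j)_k conj((s_k)_j), which is negative when the matrix ((s_j)_k)
   is antisymmetric and nonzero. *)
Require Import Defs.
From HB Require Import structures.
From mathcomp Require Import all_boot all_order all_algebra sesquilinear.
From mathcomp Require Import complex ring lra.
From mathcomp Require Import all_classical all_reals all_analysis.
From mathcomp Require Import measurable_realfun.

Set Implicit Arguments.
Unset Strict Implicit.
Unset Printing Implicit Defensive.

Import Order.TTheory GRing.Theory Num.Theory numFieldNormedType.Exports.

Local Open Scope ring_scope.
Local Open Scope classical_set_scope.
Local Open Scope complex_scope.

Lemma ord2P (i : 'I_2) : i = 0 \/ i = 1.
Proof. by case: i => -[|[|//]] ?; [left|right]; exact: val_inj. Qed.

(** * Topology of C and C^n, a countable base of boxes, and Borel sets of C^2 in real coordinates *)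

Section complex_plane.
Variable R : realType.
Local Notation C := (Cplx R).
Local Notation Re := (@complex.Re R).
Local Notation Im := (@complex.Im R).

Lemma Re_continuous : continuous (Re : C -> R).
Proof.
move=> x; apply/(@cvgrPdist_lt R R C (nbhs x) _ Re (Re x)) => e e0.
apply/nbhs_ballP; exists (e%:C : C); first by rewrite /= ltcR.
move=> y; rewrite -ball_normE /ball_ /= => xy.
by rewrite -raddfB -ltcR (le_lt_trans _ xy)// normc_ge_Re.
Qed.

Lemma conj_continuous : continuous ((fun x => x^*) : C -> C).
Proof.
move=> x; apply/(@cvgrPdist_lt C C C (nbhs x) _ (fun x : C => x^*) (x^*)) => e e0.
apply/nbhs_ballP; exists e => //=.
move=> y; rewrite -ball_normE /ball_ /= => xy.
by rewrite -raddfB normcJ.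
Qed.

Lemma Im_continuous : continuous (Im : C -> R).
Proof.
have -> : Im = (fun x : C => Re (- 'i * x)).
  by apply/funext => -[a b] /=; ring.
move=> x; apply: (@continuous_comp C C R (fun x => - 'i * x) Re);
  last exact: Re_continuous.
by apply: (@mulrl_continuous C).
Qed.

Lemma normc_le_ReIm (x : C) : `|x| <= (`|Re x| + `|Im x|)%:C.
Proof.
rewrite [x in leLHS]complexE (le_trans (ler_normD _ _))// normrM normc_def /=.
by rewrite !normc_def /= !expr0n /= add0r !addr0 expr1n !sqrtr_sqr sqrtr1 mul1r rmorphD.
Qed.

(** Boxes serve twice: with rational endpoints they form a countable base, and around a given point
    they are the sets U of the extension property. Their preimages in R^4 are products of intervals,
    so measurability and finite volume come at once. *)
Definition box n (q : 'I_n -> (R * R) * (R * R)) : set 'rV[C]_n :=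
  [set z | forall i, ((q i).1.1 < Re (z 0 i) < (q i).1.2) /\
                     ((q i).2.1 < Im (z 0 i) < (q i).2.2)].

Lemma open_strip (T : topologicalType) (f : T -> R) a b :
  continuous f -> open [set x | a < f x < b].
Proof.
move=> cf; rewrite (_ : mkset _ = f @^-1` `]a, b[%classic); last first.
  by apply/funext => x; rewrite /= in_itv.
by move/continuousP : cf; apply; exact: itv_open.
Qed.

Lemma box_open n (q : 'I_n -> (R * R) * (R * R)) : open (box q).
Proof.
rewrite openE => z qz; rewrite /interior.
apply: (@filter_forall _ _ _ (nbhs z) _) => i; have [qRe qIm] := qz i.
have cc := @coord_continuous C 1 n 0 i.
apply: filterI.
- apply: (@open_nbhs_nbhs _ z [set w : 'rV[C]_n | _ < Re (w 0 i) < _]).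
  split=> //; apply: open_strip => w.
  exact: (@continuous_comp _ C R (fun w : 'rV[C]_n => w 0 i) Re _ (cc w)
    (@Re_continuous _)).
- apply: (@open_nbhs_nbhs _ z [set w : 'rV[C]_n | _ < Im (w 0 i) < _]).
  split=> //; apply: open_strip => w.
  exact: (@continuous_comp _ C R (fun w : 'rV[C]_n => w 0 i) Im _ (cc w)
    (@Im_continuous _)).
Qed.

Definition rat_box n (q : {ffun 'I_n -> (rat * rat) * (rat * rat)}) :=
  box (fun i => ((ratr (q i).1.1, ratr (q i).1.2), (ratr (q i).2.1, ratr (q i).2.2))).

Lemma rat_itv_around (x e : R) : 0 < e ->
  exists q : rat * rat, ratr q.1 < x < ratr q.2 /\
    forall y, ratr q.1 < y < ratr q.2 -> `|x - y| < e.
Proof.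
move=> e0.
have [a /itvP ha] := @rat_in_itvoo R (x - e / 2) x ltac:(lra).
have [b /itvP hb] := @rat_in_itvoo R x (x + e / 2) ltac:(lra).
exists (a, b); split=> /=; first by rewrite ha hb.
move=> y /andP[ay yb]; rewrite ltr_norml.
have ha1 : x - e / 2 < ratr a by rewrite ha.
have hb1 : ratr b < x + e / 2 by rewrite hb.
by apply/andP; split; lra.
Qed.

Lemma rat_box_nbhs n (z : 'rV[C]_n) (A : set 'rV[C]_n) : nbhs z A ->
  exists2 q, rat_box q z & rat_box q `<=` A.
Proof.
move=> /nbhs_ballP[e /= e0 eA].
(* The radius is an element of C; being positive it is real, and half of it is allotted to each of
   the real and imaginary parts. *)
have eE : e = (Re e)%:C.
  by move: e0; rewrite ltcE /= => /andP[/eqP e0 _]; rewrite [LHS]complexE e0 mulr0 addr0.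
have Re0 : 0 < Re e by rewrite -ltcR -eE.
have /choice[f hf] : forall i, exists q : (rat * rat) * (rat * rat),
    ((ratr q.1.1 < Re (z 0 i) < ratr q.1.2) /\ (ratr q.2.1 < Im (z 0 i) < ratr q.2.2)) /\
    forall w : C, (ratr q.1.1 < Re w < ratr q.1.2) /\ (ratr q.2.1 < Im w < ratr q.2.2) ->
      `|z 0 i - w| < e.
  move=> i.
  have [p [p1 p2]] := @rat_itv_around (Re (z 0 i)) (Re e / 2) ltac:(lra).
  have [q [q1 q2]] := @rat_itv_around (Im (z 0 i)) (Re e / 2) ltac:(lra).
  exists (p, q); split=> // w /= [/p2 wp /q2 wq].
  rewrite (le_lt_trans (normc_le_ReIm _))// eE ltcR !raddfB /=.
  by rewrite [ltRHS]splitr ltrD.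
exists [ffun i => f i] => [i|w hw]; first by rewrite /= ffunE; have [] := hf i.
apply: eA; split=> // i j; rewrite ord1 -ball_normE /=.
by apply: (hf j).2; have := hw j; rewrite /= ffunE.
Qed.

Lemma second_countable_rV n : @second_countable 'rV[C]_n.
Proof.
exists (range (@rat_box n)).
  exact: card_le_trans (card_image_le _ _) (countableP _).
split=> [_ [q _ <-]|z A /= /rat_box_nbhs[q qz qA]]; first exact: box_open.
by exists (rat_box q) => //; split=> //; exists q.
Qed.

(* The coordinates come in the order of integration of [lebesgueC_integral]. *)
Definition of_R4 (p : R * (R * (R * R))) : 'rV[C]_2 :=
  row_mx (const_mx (p.1 +i* p.2.1) : 'rV[C]_1)
    (row_mx (const_mx (p.2.2.1 +i* p.2.2.2) : 'rV[C]_1) (0 : 'rV[C]_0)).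

Lemma of_R4_0 p : of_R4 p 0 0 = p.1 +i* p.2.1.
Proof. by rewrite /of_R4 mxE; case: splitP => // j _; rewrite mxE. Qed.

Lemma of_R4_1 p : of_R4 p 0 1 = p.2.2.1 +i* p.2.2.2.
Proof.
rewrite /of_R4 mxE; case: splitP => [[[|//] ?] //|k _].
by rewrite mxE; case: splitP => [j _|[]//]; rewrite mxE.
Qed.

Lemma of_R4_preimage_box (q : 'I_2 -> (R * R) * (R * R)) : of_R4 @^-1` box q =
  [set` `](q 0).1.1, (q 0).1.2[%R] `*` ([set` `](q 0).2.1, (q 0).2.2[%R] `*`
  ([set` `](q 1).1.1, (q 1).1.2[%R] `*` [set` `](q 1).2.1, (q 1).2.2[%R])).
Proof.
apply/seteqP; split=> [p /= qp|p /=].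
  have := qp 0; have := qp 1; rewrite of_R4_0 of_R4_1 /=.
  by rewrite !in_itv /= => -[-> ->] [-> ->].
rewrite !in_itv /= => -[h1 [h2 [h3 h4]]] i.
by have [->|->] := ord2P i; rewrite ?of_R4_0 ?of_R4_1.
Qed.

(** An open set is the union of the countably many rational boxes inside it, and the preimage of
    each is a measurable rectangle. This links the Borel sets of C^2 to the product sigma-algebra of
    R^4. *)
Lemma measurable_of_R4 : measurable_fun setT
  (of_R4 : _ -> g_sigma_algebraType (@open 'rV[C]_2)).
Proof.
apply: (@measurability _ _ _ (g_sigma_algebraType (@open 'rV[C]_2)) _ _ open) => //.
move=> _ [A oA <-]; rewrite setTI.
have -> : of_R4 @^-1` A =
    \bigcup_(q in [set q | @rat_box 2 q `<=` A]) (of_R4 @^-1` rat_box q).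
  apply/seteqP; split=> [p Ap|p [q qA]]; last exact: qA.
  have [q qp qA] := rat_box_nbhs (open_nbhs_nbhs (conj oA Ap)).
  by exists q.
rewrite bigcup_mkcond; apply: countable_bigcupT_measurable; first exact: countableP.
move=> q; case: ifP => // _; rewrite of_R4_preimage_box.
by do 3 (apply: measurableX => //).
Qed.

End complex_plane.

(* The library's [ge0_le_integral] assumes measurability; the supremum over
   simple functions that defines the integral is monotone without it. *)
Lemma ge0_dominated_le_integral d (T : measurableType d) (R : realType)
    (mu : {measure set T -> \bar R}) (D : set T) (f g : T -> \bar R) :
  (forall x, D x -> 0 <= f x)%E -> (forall x, D x -> f x <= g x)%E ->
  (\int[mu]_(x in D) f x <= \int[mu]_(x in D) g x)%E.
Proof.
move=> f0 fg; rewrite integral_mkcond [leRHS]integral_mkcond.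
have fD x : (0 <= (f \_ D) x)%E by rewrite patchE; case: ifPn => //; rewrite inE => /f0.
have fgD x : ((f \_ D) x <= (g \_ D) x)%E.
  by rewrite !patchE; case: ifPn => //; rewrite inE => /fg.
have gD x : (0 <= (g \_ D) x)%E by exact: le_trans (fgD x).
rewrite !ge0_integralTE//; apply: le_ereal_sup => _ [h hf <-].
by exists h => // x; exact: le_trans (hf x) (fgD x).
Qed.

(** * Image measures and products of sigma-finite measures *)

Section image_measure.
Context d d' (T : measurableType d) (T' : measurableType d') (R : realType).
Variables (m : {measure set T -> \bar R}) (f : T -> T').
Hypothesis mf : measurable_fun [set: T] f.

(** The proof of measurability is an argument so that the measure structure can be attached to the
    term. *)
Definition image_measure of measurable_fun [set: T] f := pushforward m f.

Let im0 : image_measure mf set0 = 0%E. Proof. exact: measure0. Qed.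
Let im_ge0 A : (0 <= image_measure mf A)%E. Proof. exact: measure_ge0. Qed.
Let im_sigma : semi_sigma_additive (image_measure mf).
Proof. exact: measure_semi_sigma_additive. Qed.
HB.instance Definition _ := isMeasure.Build _ _ _ (image_measure mf) im0 im_ge0 im_sigma.
End image_measure.

Section sigma_finite_product.
Local Open Scope ereal_scope.
Context d1 d2 (T1 : measurableType d1) (T2 : measurableType d2) (R : realType).
Variables (m1 : {sigma_finite_measure set T1 -> \bar R})
  (m2 : {sigma_finite_measure set T2 -> \bar R}).

(* A synonym of the product measure: the library's sigma-finite structure on
   [\x] is shadowed by the one for subprobabilities. *)
Definition sigma_finite_product : set (T1 * T2) -> \bar R := m1 \x m2.

HB.instance Definition _ := Measure.on sigma_finite_product.

Let sigma_finite_productT : sigma_finite setT sigma_finite_product.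
Proof.
have /sigma_finiteP[F [TF ndF Foo]] := sigma_finiteT m1.
have /sigma_finiteP[G [TG ndG Goo]] := sigma_finiteT m2.
exists (fun n => F n `*` G n).
  apply/esym; rewrite -subTset => -[x y] _.
  have [[n _ Fx] [k _ Gy]] : (\bigcup_n F n) x /\ (\bigcup_n G n) y.
    by rewrite -TF -TG.
  (* Both exhausting sequences are nondecreasing, so a point of F_n x G_k already lies in the stage
     max(n, k). *)
  exists (maxn n k) => //; split=> /=.
    by have /subsetPset := ndF _ _ (leq_maxl n k); apply.
  by have /subsetPset := ndG _ _ (leq_maxr n k); apply.
move=> n; have [mF Fn] := Foo n; have [mG Gn] := Goo n.
split; first exact: measurableX.
rewrite /sigma_finite_product product_measure1E//.
by rewrite lte_mul_pinfty// ge0_fin_numE.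
Qed.

HB.instance Definition _ :=
  Measure_isSigmaFinite.Build _ _ _ sigma_finite_product sigma_finite_productT.

Lemma sigma_finite_productE (A : set T1) (B : set T2) : measurable A -> measurable B ->
  sigma_finite_product (A `*` B) = m1 A * m2 B.
Proof. exact: product_measure1E. Qed.

End sigma_finite_product.

Section product4.
Local Open Scope ereal_scope.
Context d (T : measurableType d) (R : realType).
Variable m : {sigma_finite_measure set T -> \bar R}.

(** Nested to the right in the order of the iterated integral; the inner factors use the synonym
    because the second factor of a product has to be sigma-finite. *)
Definition product4 : {measure set (T * (T * (T * T))) -> \bar R} :=
  m \x sigma_finite_product m (sigma_finite_product m m).

(** A product measure is by definition the integral of the measures of sections. Unfolding this
    three times while carrying [k] inward, and writing the last measure as the integral of an
    indicator, yields the shape of [lebesgueC_integral] on C^2. *)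
Lemma product4E (k : R) (B : set (T * (T * (T * T)))) :
  (0 <= k)%R -> measurable B ->
  k%:E * product4 B = \int[m]_x \int[m]_y \int[m]_x' \int[m]_y'
    (\1_B (x, (y, (x', y'))) * k)%:E.
Proof.
move=> k0 mB.
have step d' (T' : measurableType d') (m' : {sigma_finite_measure set T' -> \bar R})
    (A : set (T * T')) (g : T -> \bar R) : measurable A ->
    (forall x, g x = k%:E * m' (xsection A x)) ->
    k%:E * (m \x m') A = \int[m]_x g x.
  move=> mA gE; rewrite /product_measure1 -ge0_integralZl//; last first.
    exact: measurable_fun_xsection.
  by apply: eq_integral => x _; rewrite gE.
apply: (step) => // x; apply/esym.
have mBx : measurable (xsection B x) by exact: measurable_xsection.
apply: (step) => // y; apply/esym.
have mBy : measurable (xsection (xsection B x) y) by exact: measurable_xsection.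
apply: (step) => // x'; apply/esym.
set Bx' := xsection _ x'; have mBx' : measurable Bx' by exact: measurable_xsection.
rewrite -[X in m X]setIT -integral_indic// -ge0_integralZl//; last first.
  exact/measurable_EFinP.
apply: eq_integral => y' _ /=.
rewrite -EFinM mulrC; congr (_ * _)%:E.
by rewrite !indicE /Bx' !mem_xsection.
Qed.

Lemma product4_box (A1 A2 A3 A4 : set T) : measurable A1 -> measurable A2 ->
  measurable A3 -> measurable A4 ->
  product4 (A1 `*` (A2 `*` (A3 `*` A4))) = m A1 * (m A2 * (m A3 * m A4)).
Proof.
move=> m1 m2 m3 m4.
have mA34 : measurable (A3 `*` A4) by exact: measurableX.
have mA234 : measurable (A2 `*` (A3 `*` A4)) by exact: measurableX.
rewrite /product4 /= product_measure1E//; congr (_ * _).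
by rewrite [LHS]sigma_finite_productE//; congr (_ * _); exact: sigma_finite_productE.
Qed.

Lemma product4_box_lty (A1 A2 A3 A4 : set T) : measurable A1 -> measurable A2 ->
  measurable A3 -> measurable A4 ->
  m A1 < +oo -> m A2 < +oo -> m A3 < +oo -> m A4 < +oo ->
  product4 (A1 `*` (A2 `*` (A3 `*` A4))) < +oo.
Proof.
move=> *; rewrite product4_box//.
by do 3 (apply: lte_mul_pinfty => //; first by rewrite ge0_fin_numE).
Qed.

End product4.

(** * The volume measure of flat C^2 *)

Section volume.
Variable R : realType.
Local Notation C := (Cplx R).
Local Notation mu := (@lebesgue_measure R).
Local Open Scope ereal_scope.

(** Lebesgue measure carried from R^4 to C^2. The factor 4 is 2^n det(omega_jk) for n = 2 and the
    standard metric. *)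
Definition vol2 : {measure set (g_sigma_algebraType (@open 'rV[C]_2)) -> \bar R} :=
  mscale (4%:R : R)%:nng%R (image_measure (product4 mu) (@measurable_of_R4 R)).

Lemma vol2E (A : set (g_sigma_algebraType (@open 'rV[C]_2))) : measurable A ->
  vol2 A = lebesgueC_integral (fun z => (\1_A z * 4)%:E).
Proof.
move=> mA; rewrite /= /vol2 /= /mscale /= /image_measure /pushforward /=.
have mB : measurable (@of_R4 R @^-1` A).
  rewrite -[X in measurable X]setTI; exact: measurable_of_R4.
by apply: (product4E mu _ mB); rewrite ler0n.
Qed.

Local Open Scope ring_scope.

Lemma vol2_box_lty q : (vol2 (box q) < +oo)%E.
Proof.
rewrite /vol2 /= /mscale /= /image_measure /pushforward of_R4_preimage_box.
have muI x y : (mu [set` `]x, y[%R] < +oo)%E.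
  by rewrite lebesgue_measure_itv /=; case: ifP => _; rewrite ?ltry// -EFinB ltry.
have mI x y : measurable ([set` `]x, y[%R] : set R) by exact: measurable_itv.
rewrite lte_mul_pinfty//.
by apply: product4_box_lty; [exact: mI..|exact: muI|exact: muI|exact: muI|exact: muI].
Qed.

End volume.

(** * Differentiation rules for real directional derivatives of complex functions *)

Section rderive.
Variables (R : realType) (n : nat).
Local Notation C := (Cplx R).
Local Notation Re := (@complex.Re R).
Local Notation Im := (@complex.Im R).
Implicit Types (f g : 'rV[C]_n -> C) (z v : 'rV[C]_n) (c d : C).

(** Relational form of [rderive]: existence and value of the derivative travel together, so each
    rule follows from the real rules for the two parts. *)
Definition is_rderive f v z d :=
  is_derive (0 : R) 1 (fun t : R => Re (f (z + t%:C *: v))) (Re d) /\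
  is_derive (0 : R) 1 (fun t : R => Im (f (z + t%:C *: v))) (Im d).

Lemma rderivableP f v z : rderivable f v z -> is_rderive f v z (rderive f v z).
Proof.
by move=> [/derivableP fRe /derivableP fIm]; split; rewrite /rderive /= derive1E.
Qed.

Lemma is_rderive_rderivable f v z d : is_rderive f v z d -> rderivable f v z.
Proof. by move=> [? ?]; split. Qed.

Lemma is_rderive_val f v z d : is_rderive f v z d -> rderive f v z = d.
Proof. by case: d => a b [? ?]; rewrite /rderive !derive1E !derive_val. Qed.

Lemma line0 z v : z + (0 : R)%:C *: v = z.
Proof. by rewrite scale0r addr0. Qed.

Lemma is_rderive_cst v z c : is_rderive (fun=> c) v z 0.
Proof. by split; exact: is_derive_cst. Qed.

Lemma is_rderive_coord v z (a : 'I_n) : is_rderive (fun w => w 0 a) v z (v 0 a).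
Proof.
split.
  rewrite (_ : (fun t => _) =
      (cst (Re (z 0 a)) \+ (fun t => t * Re (v 0 a)))); last first.
    apply/funext => t; rewrite !mxE /=.
    by case: (z 0 a) (v 0 a) => [? ?] [? ?] /=; ring.
  by apply: is_derive_eq; rewrite /= add0r scaler0 add0r /GRing.scale /= mulr1.
rewrite (_ : (fun t => _) =
      (cst (Im (z 0 a)) \+ (fun t => t * Im (v 0 a)))); last first.
  apply/funext => t; rewrite !mxE /=.
    by case: (z 0 a) (v 0 a) => [? ?] [? ?] /=; ring.
by apply: is_derive_eq; rewrite /= add0r scaler0 add0r /GRing.scale /= mulr1.
Qed.

Lemma is_rderiveD f g v z d d' : is_rderive f v z d -> is_rderive g v z d' ->
  is_rderive (fun w => f w + g w) v z (d + d').
Proof.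
by move=> [? ?] [? ?]; split; rewrite raddfD /=; under eq_fun do rewrite raddfD /=;
  exact: is_deriveD.
Qed.

Lemma is_rderive_conj f v z d : is_rderive f v z d ->
  is_rderive (fun w => (f w)^*) v z d^*.
Proof.
have Re_conj (x : C) : Re x^* = Re x by case: x.
have Im_conj (x : C) : Im x^* = - Im x by case: x.
move=> [? ?]; split; rewrite ?Re_conj ?Im_conj.
  by under eq_fun do rewrite Re_conj.
by under eq_fun do rewrite Im_conj; exact: is_deriveN.
Qed.

Lemma ReM (x y : C) : Re (x * y) = Re x * Re y - Im x * Im y.
Proof. by case: x y => [? ?] [? ?]. Qed.

Lemma ImM (x y : C) : Im (x * y) = Re x * Im y + Im x * Re y.
Proof. by case: x y => [? ?] [? ?]. Qed.

Lemma is_rderiveM f g v z d d' : is_rderive f v z d -> is_rderive g v z d' ->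
  is_rderive (fun w => f w * g w) v z (d * g z + f z * d').
Proof.
move=> [f1 f2] [g1 g2]; split; rewrite raddfD /= ?ReM ?ImM.
  under eq_fun do rewrite ReM.
  by apply: is_derive_eq; rewrite /GRing.scale /= !line0; ring.
under eq_fun do rewrite ImM.
by apply: is_derive_eq; rewrite /GRing.scale /= !line0; ring.
Qed.

Lemma ReV (x : C) : Re x^-1 = Re x * (Re x ^+ 2 + Im x ^+ 2)^-1.
Proof. by case: x. Qed.

Lemma ImV (x : C) : Im x^-1 = - Im x * (Re x ^+ 2 + Im x ^+ 2)^-1.
Proof. by case: x => ? ? /=; rewrite mulNr. Qed.

Lemma is_rderiveV f v z d : f z != 0 -> is_rderive f v z d ->
  is_rderive (fun w => (f w)^-1) v z (- d * (f z)^-1 ^+ 2).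
Proof.
move=> fz0 [f1 f2].
have D0 : Re (f z) ^+ 2 + Im (f z) ^+ 2 != 0.
  apply: contra fz0; rewrite paddr_eq0 ?sqr_ge0// !sqrf_eq0 => /andP[/eqP r0 /eqP i0].
  by apply/eqP; rewrite [LHS]complexE r0 i0 mulr0 addr0.
(* The same fact at t = 0 on the line, in the form in which the rule for the real inverse needs
   it. *)
have D1 : Re (f (z + (0 : R)%:C *: v)) ^+ 2 +
    Im (f (z + (0 : R)%:C *: v)) ^+ 2 != 0 by rewrite line0.
split; rewrite expr2 !(ReM, ImM, ReV, ImV, raddfN) /=.
  under eq_fun do rewrite ReV.
  apply: is_derive_eq; rewrite /GRing.scale /= line0 !expr2.
  by move: (Re (f z)) (Im (f z)) D0 => a b; rewrite !expr2 => D0; field.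
under eq_fun do rewrite ImV.
apply: is_derive_eq; rewrite /GRing.scale /= line0 !expr2.
by move: (Re (f z)) (Im (f z)) D0 => a b; rewrite !expr2 => D0; field.
Qed.

End rderive.

(** * Closure of C^k functions on the whole space under the field operations and conjugation *)

Section smooth.
Variables (R : realType) (n : nat).
Local Notation C := (Cplx R).
Implicit Types (f g : 'rV[C]_n -> C) (z v : 'rV[C]_n) (c d : C).

Lemma Ck_onS k (A : set 'rV[C]_n) f : Ck_on k.+1 A f -> Ck_on k A f.
Proof.
elim: k f => [|k IH] f [cf df]; split=> // v.
by have [dfv dfC] := df v; split=> //; exact: IH.
Qed.

Lemma Ck_onT_rderivable k f v z : Ck_on k.+1 setT f -> rderivable f v z.
Proof. by move=> [_ /(_ v)[dfv _]]; exact: dfv. Qed.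

Lemma Ck_onT_rderive k f v : Ck_on k.+1 setT f -> Ck_on k setT (rderive f v).
Proof. by move=> [_ /(_ v)[_ dfv]]. Qed.

Lemma Ck_onT_continuous k f : Ck_on k setT f -> continuous f.
Proof. by case: k => [|k] [cf _] z; exact: cf. Qed.

(** The induction step of the closure lemmas: it suffices to exhibit a formula [df] for the
    derivative and to show that it is one degree less smooth. *)
Lemma Ck_onTS k f (df : 'rV[C]_n -> 'rV[C]_n -> C) : continuous f ->
  (forall v z, is_rderive f v z (df v z)) -> (forall v, Ck_on k setT (df v)) ->
  Ck_on k.+1 setT f.
Proof.
move=> cf dfP dfC; split=> [z _|v]; first exact: cf.
split=> [z _|]; first exact: is_rderive_rderivable (dfP v z).
rewrite (_ : rderive f v = df v)//.
by apply/funext => z; exact: is_rderive_val.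
Qed.

Lemma Ck_onT0 f : continuous f -> Ck_on 0 setT f.
Proof. by move=> cf; split=> // z _; exact: cf. Qed.

Lemma continuous_cplxD f g : continuous f -> continuous g ->
  continuous (fun w => f w + g w).
Proof. by move=> cf cg z; exact: (@continuousD C _ _ f g z (cf z) (cg z)). Qed.

Lemma continuous_cplxM f g : continuous f -> continuous g ->
  continuous (fun w => f w * g w).
Proof. by move=> cf cg z; exact: (@continuousM C _ f g z (cf z) (cg z)). Qed.

Lemma continuous_cplx_conj f : continuous f -> continuous (fun w => (f w)^* : C).
Proof.
move=> cf z.
exact: (@continuous_comp _ C C f (fun x => x^*) _ (cf z) (@conj_continuous R _)).
Qed.

Lemma continuous_cplxV f : (forall z, f z != 0) -> continuous f ->
  continuous (fun w => (f w)^-1).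
Proof. by move=> f0 cf z; exact: (@cvgV C _ (nbhs z) _ f (f z) (f0 z) (cf z)). Qed.

Lemma Ck_onT_cst k c : Ck_on k setT (fun _ : 'rV[C]_n => c).
Proof.
elim: k c => [|k IH] c; first by apply: Ck_onT0 => z; exact: (@cst_continuous _ C c).
apply: (@Ck_onTS k (fun=> c) (fun _ _ => 0)).
- by move=> z; exact: (@cst_continuous _ C c).
- by move=> v z; exact: is_rderive_cst.
- by move=> v; exact: IH.
Qed.

Lemma Ck_onT_coord k (a : 'I_n) : Ck_on k setT (fun w : 'rV[C]_n => w 0 a).
Proof.
case: k => [|k]; first by apply: Ck_onT0; exact: coord_continuous.
apply: (@Ck_onTS _ _ (fun v _ => v 0 a)) => [|v z|v]; first exact: coord_continuous.
  exact: is_rderive_coord.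
exact: Ck_onT_cst.
Qed.

Lemma Ck_onTD k f g : Ck_on k setT f -> Ck_on k setT g ->
  Ck_on k setT (fun w => f w + g w).
Proof.
elim: k f g => [|k IH] f g fk gk.
  apply/Ck_onT0/continuous_cplxD; first exact: Ck_onT_continuous fk.
  exact: Ck_onT_continuous gk.
apply: (@Ck_onTS _ _ (fun v z => rderive f v z + rderive g v z)).
- by apply: continuous_cplxD; [exact: Ck_onT_continuous fk|exact: Ck_onT_continuous gk].
- move=> v z; apply: is_rderiveD; apply: rderivableP.
    exact: Ck_onT_rderivable fk.
  exact: Ck_onT_rderivable gk.
- by move=> v; apply: IH; exact: Ck_onT_rderive.
Qed.

Lemma Ck_onT_conj k f : Ck_on k setT f -> Ck_on k setT (fun w => (f w)^* : C).
Proof.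
elim: k f => [|k IH] f fk.
  by apply/Ck_onT0/continuous_cplx_conj; exact: Ck_onT_continuous fk.
apply: (@Ck_onTS _ _ (fun v z => (rderive f v z)^*)).
- by apply: continuous_cplx_conj; exact: Ck_onT_continuous fk.
- by move=> v z; apply: is_rderive_conj; apply: rderivableP; exact: Ck_onT_rderivable fk.
- by move=> v; apply: IH; exact: Ck_onT_rderive.
Qed.

Lemma Ck_onTM k f g : Ck_on k setT f -> Ck_on k setT g ->
  Ck_on k setT (fun w => f w * g w).
Proof.
elim: k f g => [|k IH] f g fk gk.
  apply/Ck_onT0/continuous_cplxM; first exact: Ck_onT_continuous fk.
  exact: Ck_onT_continuous gk.
apply: (@Ck_onTS _ _ (fun v z => rderive f v z * g z + f z * rderive g v z)).
- by apply: continuous_cplxM; [exact: Ck_onT_continuous fk|exact: Ck_onT_continuous gk].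
- move=> v z; apply: is_rderiveM; apply: rderivableP.
    exact: Ck_onT_rderivable fk.
  exact: Ck_onT_rderivable gk.
- move=> v; apply: Ck_onTD; apply: IH.
  + exact: Ck_onT_rderive.
  + exact: Ck_onS.
  + exact: Ck_onS.
  + exact: Ck_onT_rderive.
Qed.

(** The derivative -f'/f^2 contains 1/f again, which is of class C^k by the induction hypothesis for
    the same [f]. *)
Lemma Ck_onTV k f : (forall z, f z != 0) -> Ck_on k setT f ->
  Ck_on k setT (fun w => (f w)^-1).
Proof.
move=> f0; elim: k => [|k IH] fk.
  by apply/Ck_onT0/continuous_cplxV => //; exact: Ck_onT_continuous fk.
(* The sign is written as a constant factor and the square as a product, so that closure under
   products suffices. *)
apply: (@Ck_onTS _ _ (fun v z => (-1 * rderive f v z) * ((f z)^-1 * (f z)^-1))).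
- by apply: continuous_cplxV => //; exact: Ck_onT_continuous fk.
- move=> v z.
  have -> : (-1 * rderive f v z) * ((f z)^-1 * (f z)^-1) =
      - rderive f v z * (f z)^-1 ^+ 2 by rewrite expr2 mulN1r.
  exact: (is_rderiveV (f0 z) (rderivableP (Ck_onT_rderivable v z fk))).
- have fVk := IH (Ck_onS fk).
  move=> v; apply: Ck_onTM; last exact: Ck_onTM.
  by apply: Ck_onTM; [exact: Ck_onT_cst|exact: Ck_onT_rderive].
Qed.

End smooth.

(** * Wirtinger derivatives *)

Section wirtinger.
Variables (R : realType) (n : nat).
Local Notation C := (Cplx R).
Implicit Types (f g : 'rV[C]_n -> C) (z v : 'rV[C]_n) (c d : C).

(** The real differential of [f] at [z] is \sum_j (p_j dz_j + q_j dzbar_j). Keeping both families of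
    coefficients makes the calculus closed under conjugation, which exchanges them. *)
Definition wirtinger f z (p q : 'I_n -> C) :=
  forall v, is_rderive f v z (\sum_j (p j * v 0 j + q j * (v 0 j)^*)).

Lemma wirtinger_rderive f z p q c j : wirtinger f z p q ->
  rderive f (c *: delta_mx 0 j) z = p j * c + q j * c^*.
Proof.
move=> fpq; rewrite (is_rderive_val (fpq _)) (bigD1 j)//= big1 => [|i ij].
  by rewrite !mxE !eqxx mulr1 addr0.
by rewrite !mxE /= (negbTE ij) !mulr0 rmorph0 mulr0 addr0.
Qed.

Lemma wirtinger_rderive1 f z p q j : wirtinger f z p q ->
  rderive f (delta_mx 0 j) z = p j + q j.
Proof.
move=> fpq; rewrite -[delta_mx 0 j]scale1r (wirtinger_rderive _ _ fpq) mulr1.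
by congr (_ + _); rewrite -[RHS]mulr1; congr (_ * _); exact: conjc1.
Qed.

Lemma wirtinger_rderivei f z p q j : wirtinger f z p q ->
  rderive f ((0 +i* 1) *: delta_mx 0 j) z = (p j - q j) * (0 +i* 1).
Proof.
move=> fpq; rewrite (wirtinger_rderive _ _ fpq) mulrBl -mulrN.
by congr (_ + _ * _); rewrite /conjc; apply/eqP; rewrite eq_complex /= oppr0 !eqxx.
Qed.

Lemma mulcii : (0 +i* 1 : C) * (0 +i* 1) = -1.
Proof. by rewrite -[LHS]expr2 [LHS](sqr_i R). Qed.

(** The derivatives along e_j and i e_j are p_j + q_j and i (p_j - q_j); the combination defining
    [dz] cancels q_j. *)
Lemma wirtinger_dz f z p q j : wirtinger f z p q -> dz j f z = p j.
Proof.
move=> fpq; rewrite /dz (wirtinger_rderive1 _ fpq) (wirtinger_rderivei _ fpq).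
rewrite mulrCA mulcii mulrN1 opprK addrACA subrr addr0.
by rewrite -mulr2n -[X in X / _]mulr_natr mulfK// pnatr_eq0.
Qed.

Lemma wirtinger_dzbar f z p q j : wirtinger f z p q -> dzbar j f z = q j.
Proof.
move=> fpq; rewrite /dzbar (wirtinger_rderive1 _ fpq) (wirtinger_rderivei _ fpq).
rewrite mulrCA mulcii mulrN1 opprB addrCA [p j + _]addrC addrK.
by rewrite -mulr2n -[X in X / _]mulr_natr mulfK// pnatr_eq0.
Qed.

Lemma wirtinger_eq f z p q p' q' : wirtinger f z p q -> p =1 p' -> q =1 q' ->
  wirtinger f z p' q'.
Proof. by move=> fpq pp qq v; under eq_bigr do rewrite -pp -qq; exact: fpq. Qed.

Lemma wirtinger_cst z c : wirtinger (fun=> c) z (fun=> 0) (fun=> 0).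
Proof.
by move=> v; rewrite big1 => [|j _]; rewrite ?mul0r ?addr0//; exact: is_rderive_cst.
Qed.

Lemma wirtinger_coord z (a : 'I_n) :
  wirtinger (fun w => w 0 a) z (fun j => (a == j)%:R) (fun=> 0).
Proof.
move=> v; rewrite (bigD1 a)//= big1 => [|j /negbTE ja]; last first.
  by rewrite eq_sym ja !mul0r addr0.
by rewrite eqxx mul1r mul0r !addr0; exact: is_rderive_coord.
Qed.

Lemma wirtinger_conj f z p q : wirtinger f z p q ->
  wirtinger (fun w => (f w)^*) z (fun j => (q j)^*) (fun j => (p j)^*).
Proof.
move=> fpq v; have := is_rderive_conj (fpq v).
congr is_rderive; rewrite rmorph_sum /=; apply: eq_bigr => j _.
by rewrite rmorphD !rmorphM /= conjcK addrC.
Qed.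

Lemma wirtingerD f g z p q p' q' : wirtinger f z p q -> wirtinger g z p' q' ->
  wirtinger (fun w => f w + g w) z (fun j => p j + p' j) (fun j => q j + q' j).
Proof.
move=> fpq gpq v; have := is_rderiveD (fpq v) (gpq v).
congr is_rderive; rewrite -big_split; apply: eq_bigr => j _ /=; ring.
Qed.

Lemma wirtingerM f g z p q p' q' : wirtinger f z p q -> wirtinger g z p' q' ->
  wirtinger (fun w => f w * g w) z
    (fun j => p j * g z + f z * p' j) (fun j => q j * g z + f z * q' j).
Proof.
move=> fpq gpq v; have := is_rderiveM (fpq v) (gpq v).
congr is_rderive; rewrite mulr_suml mulr_sumr -big_split; apply: eq_bigr => j _ /=; ring.
Qed.

Lemma wirtingerV f z p q : f z != 0 -> wirtinger f z p q ->
  wirtinger (fun w => (f w)^-1) z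
    (fun j => - p j * (f z)^-1 ^+ 2) (fun j => - q j * (f z)^-1 ^+ 2).
Proof.
move=> f0 fpq v; have := is_rderiveV f0 (fpq v).
congr is_rderive; rewrite mulNr mulr_suml -sumrN; apply: eq_bigr => j _ /=; ring.
Qed.

End wirtinger.

(** * Norms of pure tensor powers *)

Section tensor.
Variables (R : realType) (V : vectType (Cplx R)).
Local Notation C := (Cplx R).

Lemma dot_real (h : innerProduct R V) a : h a a = (norm2 h a)%:C.
Proof.
have h0 : 0 <= h a a.
  have [->|/neq0_dnorm_gt0 /ltW//] := eqVneq a 0; by rewrite linear0l.
move: h0; rewrite lecE /= => /andP[/eqP h0 _].
by rewrite /norm2 [LHS]complexE h0 mulr0 addr0.
Qed.

Lemma norm2_ge0 (h : innerProduct R V) a : 0 <= norm2 h a.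
Proof.
have [->|/(neq0_dnorm_gt0 (s := h))] := eqVneq a 0; first by rewrite /norm2 linear0l.
by rewrite ltcE /= => /andP[_ /ltW].
Qed.

Lemma tensor_coord_pure_power r (e : r.-tuple V) m (a : V) J :
  tensor_coord e (pure_power m a) J = \prod_k coord e (J k) a.
Proof. by rewrite /tensor_coord /=; apply: eq_bigr => k _; rewrite lfunE. Qed.

Lemma tensor_norm2_pure_power (h : innerProduct R V) m (a : V) :
  tensor_norm2 h (pure_power m a) = norm2 h a ^+ m.
Proof.
have haa : h a a = \sum_i \sum_j
    (coord (vbasis {:V}) i a * (coord (vbasis {:V}) j a)^* *
     h (tnth (vbasis {:V}) i) (tnth (vbasis {:V}) j)).
  rewrite {1}(coord_vbasis (memvf a)) linear_sumlz; apply: eq_bigr => i _.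
  rewrite linearZl_LR /= {2}(coord_vbasis (memvf a)) linear_sumr mulr_sumr.
  apply: eq_bigr => j _; rewrite linearZr_LR /= mulrA !(tnth_nth 0).
  by [].
suff : \sum_(I : {ffun 'I_m -> 'I_(\dim {:V})})
    \sum_(J : {ffun 'I_m -> 'I_(\dim {:V})})
      tensor_coord (vbasis {:V}) (pure_power m a) I *
      (tensor_coord (vbasis {:V}) (pure_power m a) J)^* *
      \prod_k h (tnth (vbasis {:V}) (I k)) (tnth (vbasis {:V}) (J k)) = h a a ^+ m.
  by rewrite /tensor_norm2 /= => ->; rewrite dot_real -rmorphXn.
(* The power h(a, a)^m is a product over the m factors of a double sum over the basis; distributing
   the product over both sums produces the multi-indices [I] and [J]. *)
rewrite haa -[in RHS](card_ord m) -prodr_const bigA_distr_bigA.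
apply: eq_bigr => I _; rewrite bigA_distr_bigA; apply: eq_bigr => J _.
rewrite !tensor_coord_pure_power big_split; congr (_ * _).
by rewrite big_split rmorph_prod.
Qed.

End tensor.

(** * Conjugation prepared for algebraic identities *)

Section cconj.
Variable R : realType.
Local Notation C := (Cplx R).

(** A separate name protected from simplification: [cconjE] pushes it down to the coordinates, whose
    conjugates [ring] and [field] then treat as atoms. *)
Definition cconj (x : C) : C := conjc x.

Lemma cconjD (x y : C) : cconj (x + y) = cconj x + cconj y.
Proof. exact: (rmorphD (@conjc R)). Qed.
Lemma cconjN (x : C) : cconj (- x) = - cconj x.
Proof. exact: (rmorphN (@conjc R)). Qed.
Lemma cconjM (x y : C) : cconj (x * y) = cconj x * cconj y.
Proof. exact: (rmorphM (@conjc R)). Qed.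
Lemma cconjV (x : C) : cconj x^-1 = (cconj x)^-1.
Proof. exact: (fmorphV (@conjc R)). Qed.
Lemma cconj1 : cconj 1 = 1. Proof. exact: (rmorph1 (@conjc R)). Qed.
Lemma cconj0 : cconj 0 = 0. Proof. exact: (rmorph0 (@conjc R)). Qed.
Lemma cconjK (x : C) : cconj (cconj x) = x. Proof. exact: conjcK. Qed.
Lemma mul_cconj_ge0 (x : C) : 0 <= x * cconj x. Proof. exact: mulcJ_ge0. Qed.
Lemma mul_cconj_eq0 (x : C) : (x * cconj x == 0) = (x == 0).
Proof. by rewrite mulf_eq0 (conjc_eq0 x : (cconj x == 0) = _) orbb. Qed.

Definition cconjE := (cconjD, cconjN, cconjM, cconjV, cconj1, cconj0, cconjK).
End cconj.

Arguments cconj : simpl never.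

(** * The quotient metric as a family of inner products on C^2 *)

Section quotient_metric.
Variable R : realType.
Local Notation C := (Cplx R).
Local Notation V := 'rV[C]_2.
Implicit Types (u v w : V).

(** Squared norm of the vector (1, w_0, w_1) that spans the line. *)
Definition den w : C := 1 + w 0 0 * cconj (w 0 0) + w 0 1 * cconj (w 0 1).

Lemma den_gt0 w : 0 < den w.
Proof. by rewrite ltr_wpDr ?mul_cconj_ge0// ltr_wpDr ?mul_cconj_ge0// ltr01. Qed.

Lemma den_neq0 w : den w != 0.
Proof. by rewrite gt_eqF ?den_gt0. Qed.

Lemma cconj_den w : cconj (den w) = den w.
Proof. by rewrite /den !cconjE [_ * w 0 0]mulrC [_ * w 0 1]mulrC. Qed.

(* The quotient norm |u|^2 - |<u, w>|^2 / (1 + |w|^2) of u equals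
   (|u|^2 + |wedge u w|^2) / (1 + |w|^2) by Lagrange's identity; the latter form,
   polarized in [qdot], is visibly positive. *)
Definition wedge u w : C := u 0 0 * w 0 1 + - u 0 1 * w 0 0.

Definition qdot w u v : C :=
  (u 0 0 * cconj (v 0 0) + u 0 1 * cconj (v 0 1) + wedge u w * cconj (wedge v w)) *
  (den w)^-1.

Lemma qdot_bilinear w :
  bilinear_for ( *%R : GRing.Scale.law C C)
    (@Num.conj C \; *%R : GRing.Scale.law C C) (qdot w).
Proof.
split=> [v a u1 u2|u a v1 v2].
  rewrite -[LHS]/(qdot w (a *: u1 + u2) v).
  rewrite -[RHS]/(a * qdot w u1 v + qdot w u2 v).
  by rewrite /qdot /wedge !mxE; ring.
rewrite -[RHS]/(cconj a * qdot w u v1 + qdot w u v2).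
by rewrite /qdot /wedge !mxE !cconjE; ring.
Qed.

HB.instance Definition _ w :=
  @bilinear_isBilinear.Build C V V C _ _ (qdot w) (qdot_bilinear w).

Lemma qdotC w u v : qdot w u v = cconj (qdot w v u).
Proof. by rewrite /qdot [RHS]cconjM cconjV cconj_den /wedge !cconjE; ring. Qed.

Lemma qdot_herm w u v : qdot w u v = (-1) ^+ false * Num.conj (qdot w v u).
Proof. by rewrite expr0 mul1r qdotC. Qed.

HB.instance Definition _ w := isHermitianSesquilinear.Build C V false
  (@Num.conj C) (qdot w) (qdot_herm w).

Lemma qdot_gt0 w u : u != 0 -> 0 < qdot w u u.
Proof.
move=> u0; rewrite divr_gt0 ?den_gt0// ltr_wpDr ?mul_cconj_ge0//.
rewrite lt_def addr_ge0 ?mul_cconj_ge0// andbT paddr_eq0 ?mul_cconj_ge0//.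
apply: contra u0; rewrite !mul_cconj_eq0 => /andP[/eqP u00 /eqP u01].
by apply/eqP/rowP => i; rewrite mxE; have [->|->] := ord2P i.
Qed.

HB.instance Definition _ w := isDotProduct.Build C V (qdot w) (qdot_gt0 w).

Definition quotient_metric w : innerProduct R V := qdot w.
End quotient_metric.

(** * The extending sections, their norm bound, and smoothness of the metric *)

Section estimate.
Variable R : realType.
Local Notation C := (Cplx R).
Local Notation V := 'rV[C]_2.
Implicit Types (u v w z a : V).

(* The vector of C^3 = C (+) C^2 of least norm over [a] in E_z is
   (c, a + c z) with c = [lift_coef z a]. *)
Definition lift_coef z a : C := - (a 0 0 * cconj (z 0 0) + a 0 1 * cconj (z 0 1)) / den z.

(** The image in E_w of the constant vector (c, a + c z): subtracting c (1, w) leaves (0, a + c (z -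
    w)). It is affine in [w], hence holomorphic. *)
Definition peak_section z a w : V := a + lift_coef z a *: (z - w).

Lemma peak_sectionE z a : peak_section z a z = a.
Proof. by rewrite /peak_section subrr scaler0 addr0. Qed.

(** For this [c] the vector (c, a + c z) is orthogonal to (1, z), so passing to the quotient loses
    no norm. *)
Lemma qdot_lift z a (c : C) : c = lift_coef z a ->
  qdot z a a = c * cconj c + (a + c *: z) 0 0 * cconj ((a + c *: z) 0 0) +
               (a + c *: z) 0 1 * cconj ((a + c *: z) 0 1).
Proof.
move=> cE.
have cJ : cconj c = - (cconj (a 0 0) * z 0 0 + cconj (a 0 1) * z 0 1) / den z.
  by rewrite cE /lift_coef cconjM cconjV cconj_den !cconjE.
rewrite !mxE !(cconjD, cconjM) cJ cE /lift_coef /qdot /wedge !cconjE.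
by have := den_neq0 z; rewrite /den => d0; field.
Qed.

Lemma qdot_quotient_le w (c : C) b :
  qdot w (b - c *: w) (b - c *: w) <=
  c * cconj c + b 0 0 * cconj (b 0 0) + b 0 1 * cconj (b 0 1).
Proof.
rewrite -subr_ge0.
(* The loss of norm is |<(c, b), (1, w)>|^2 / (1 + |w|^2), the squared length of the component of
   (c, b) along the line. *)
have -> : c * cconj c + b 0 0 * cconj (b 0 0) + b 0 1 * cconj (b 0 1) -
    qdot w (b - c *: w) (b - c *: w) =
    (c + b 0 0 * cconj (w 0 0) + b 0 1 * cconj (w 0 1)) *
    cconj (c + b 0 0 * cconj (w 0 0) + b 0 1 * cconj (w 0 1)) / den w.
  rewrite /qdot /wedge !mxE !cconjE.
  by have := den_neq0 w; rewrite /den => d0; field.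
by apply: divr_ge0; [exact: mul_cconj_ge0|exact/ltW/den_gt0].
Qed.

Lemma peak_section_le z a w :
  norm2 (quotient_metric w) (peak_section z a w) <= norm2 (quotient_metric z) a.
Proof.
rewrite -lecR -!dot_real /= [leRHS](qdot_lift (erefl _)).
suff -> : peak_section z a w = (a + lift_coef z a *: z) - lift_coef z a *: w.
  exact: qdot_quotient_le.
by rewrite /peak_section scalerBr addrA.
Qed.

(** The right side is shaped as nested sums and products so that the Wirtinger rules apply to it
    directly. *)
Lemma quotient_metric_gram w (a b : 'I_2) :
  qdot w (delta_mx 0 a) (delta_mx 0 b) =
  (a == b)%:R + -1 * (cconj (w 0 a) * (w 0 b * (den w)^-1)).
Proof.
have := den_neq0 w; rewrite /den => d0.
by have [->|->] := ord2P a; have [->|->] := ord2P b;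
  rewrite /qdot /wedge /den !mxE /= !cconjE; field.
Qed.

Lemma Ck_onT_den k : Ck_on k setT (@den R).
Proof.
apply: Ck_onTD; [apply: Ck_onTD; first exact: Ck_onT_cst|]; apply: Ck_onTM;
  do ?exact: Ck_onT_coord; apply: Ck_onT_conj; exact: Ck_onT_coord.
Qed.

Lemma Ck_onT_qdot k u v : Ck_on k setT (fun w => qdot w u v).
Proof.
have wedgeC x : Ck_on k setT (wedge x).
  by apply: Ck_onTD; apply: Ck_onTM; (exact: Ck_onT_cst || exact: Ck_onT_coord).
apply: Ck_onTM; last by apply: Ck_onTV (Ck_onT_den k); exact: den_neq0.
apply: Ck_onTD; first exact: Ck_onT_cst.
by apply: Ck_onTM => //; exact: Ck_onT_conj.
Qed.

End estimate.

(** * The Chern connection, and its curvature at the origin *)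

Section curvature.
Variable R : realType.
Local Notation C := (Cplx R).
Local Notation V := 'rV[C]_2.
Implicit Types (w : V).

Lemma wirtinger_cconj_coord w (a : 'I_2) :
  wirtinger (fun w => cconj (w 0 a)) w (fun=> 0) (fun j => (a == j)%:R).
Proof.
apply: wirtinger_eq (wirtinger_conj (wirtinger_coord w a)) _ _ => j.
  exact: cconj0.
by case: (a == j); [exact: cconj1|exact: cconj0].
Qed.

Lemma wirtinger_den w :
  wirtinger (@den R) w (fun j => cconj (w 0 j)) (fun j => w 0 j).
Proof.
have W (a : 'I_2) := wirtingerM (wirtinger_coord w a) (wirtinger_cconj_coord w a).
apply: wirtinger_eq (wirtingerD (wirtingerD (wirtinger_cst w 1) (W 0)) (W 1)) _ _ => j /=;
  by have [->|->] := ord2P j; rewrite ?eqxx /=; ring.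
Qed.

Lemma wirtinger_den_inv w : wirtinger (fun w => (den w)^-1) w
  (fun j => - cconj (w 0 j) * (den w)^-1 ^+ 2) (fun j => - w 0 j * (den w)^-1 ^+ 2).
Proof. exact: wirtingerV (den_neq0 w) (wirtinger_den w). Qed.

Definition qgram w : 'M[C]_2 := \matrix_(a, b) qdot w (delta_mx 0 a) (delta_mx 0 b).

(** Closed form of the connection matrix (dH/dw_j) H^-1, whose only nonzero column is the j-th. *)
Definition qconn (j : 'I_2) w : 'M[C]_2 :=
  \matrix_(a, b) ((-1 * (b == j)%:R) * (cconj (w 0 a) * (den w)^-1)).

(** Multiplying the connection matrix back by H avoids the inverse: differentiating H_ab gives -
    (conj(w_a) / (1 + |w|^2)) H_jb. *)
Lemma dz_qgram j w : dz_mx j qgram w = qconn j w *m qgram w.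
Proof.
apply/matrixP => a b; rewrite !mxE (bigD1 j)//= big1 => [|i /negbTE ij]; last first.
  by rewrite !mxE ij /= mulr0 !mul0r.
rewrite !mxE eqxx mulr1 addr0.
have -> : (fun w => qgram w a b) =
    (fun w => (a == b)%:R + -1 * (cconj (w 0 a) * (w 0 b * (den w)^-1))).
  by apply/funext => x; rewrite mxE quotient_metric_gram.
rewrite (wirtinger_dz _ (wirtingerD (wirtinger_cst w _) (wirtingerM (wirtinger_cst w _)
  (wirtingerM (wirtinger_cconj_coord w a) (wirtingerM (wirtinger_coord w b)
  (wirtinger_den_inv w)))))) /=.
by rewrite quotient_metric_gram eq_sym; ring.
Qed.

Lemma qgram_unit w : qgram w \in unitmx.
Proof.
(* The inverse of the identity minus a rank-one matrix, from the Sherman-Morrison formula. *)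
pose B : 'M[C]_2 := \matrix_(a, b) ((a == b)%:R + cconj (w 0 a) * w 0 b).
suff HB : qgram w *m B = 1%:M by exact: (mulmx1_unit HB).1.
apply/matrixP => a b; rewrite !mxE big_ord_recl big_ord1.
have -> : lift ord0 ord0 = 1 :> 'I_2 by apply: val_inj.
have -> : ord0 = 0 :> 'I_2 by apply: val_inj.
rewrite !mxE !quotient_metric_gram.
have := den_neq0 w; rewrite /den => d0.
by have [->|->] := ord2P a; have [->|->] := ord2P b; rewrite /= ; field.
Qed.

(** At the origin conj(w_a) vanishes and the denominator is 1, so only the derivative of conj(w_a),
    which is 1 for a = k and 0 otherwise, survives. *)
Lemma dzbar_qconn j k : dzbar_mx k (qconn j) 0 = - delta_mx k j.
Proof.
apply/matrixP => a b; rewrite !mxE.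
have -> : (fun w => qconn j w a b) =
    (fun w => (-1 * (b == j)%:R) * (cconj (w 0 a) * (den w)^-1)).
  by apply/funext => x; rewrite mxE.
rewrite (wirtinger_dzbar _ (wirtingerM (wirtinger_cst _ _)
  (wirtingerM (wirtinger_cconj_coord _ a) (wirtinger_den_inv _)))) /=.
rewrite /den !mxE !mul0r !addr0 invr1 (_ : cconj 0 = 0) ?cconj0//.
by case: (a == k); case: (b == j); rewrite /=; ring.
Qed.

Lemma qcurvature j k :
  - dzbar_mx k (fun w => dz_mx j qgram w *m invmx (qgram w)) 0 = delta_mx k j.
Proof.
rewrite -[RHS]opprK -dzbar_qconn; congr (- dzbar_mx k _ 0).
by apply/funext => w; rewrite dz_qgram mulmxK// qgram_unit.
Qed.

End curvature.

(** * The manifold, the bundle and the two properties *)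

Section example.
Variable R : realType.
Local Notation C := (Cplx R).
Local Notation V := 'rV[C]_2.

(** One global chart, the identity. The structures of this section are left transparent because
    later steps compute with their fields. *)
Definition C2 : complexManifold R 2.
Proof.
refine (@ComplexManifold R 2 V (@norm_hausdorff _ _) (@second_countable_rV R 2)
  unit (fun=> setT) (fun=> id) (fun=> id) _ _ _ _ _ _ _).
- by move=> _; exact: openT.
- by move=> x; exists tt.
- by move=> _; rewrite image_id; exact: openT.
- by [].
- by move=> _ x _; exact: cvg_id.
- by move=> _ x _; exact: cvg_id.
- by move=> _ _ x _ _; have [] := @is_diff_id C V x.
Defined.

(** The metric is flat: [quotient_metric] at 0 is the standard inner product, used at every
    point. *)
Definition hermitian_C2 : hermitianManifold R 2.
Proof.
refine (@HermitianManifold R 2 C2 (fun _ _ => quotient_metric 0) _ _ (vol2 R) _).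
- move=> i j x _ _ u v.
  have -> : 'd ((@cmap R 2 C2 j : V -> V) \o (@cinv R 2 C2 i : V -> V))
      (@cmap R 2 C2 i x) = id :> (V -> V).
    by have [_] := @is_diff_id C V (x : V).
  by [].
- move=> i u v i' k; rewrite (_ : _ @` _ = setT).
    exact: (Ck_onT_cst 2 k (quotient_metric 0 u v)).
  by rewrite /= setIT image_id.
- move=> i A mA _; apply: etrans (vol2E mA) _.
  congr (lebesgueC_integral _); apply/funext => z.
  rewrite /= image_id; congr (_ * _)%:E.
  rewrite (_ : \matrix_(_, _) _ = 1%:M).
    by rewrite det1 /= mulr1 -natrX.
  apply/matrixP => a b; rewrite !mxE [LHS]quotient_metric_gram !mxE.
  by rewrite (cconj0 R) mul0r mulr0 addr0.
Defined.

Definition std_frame (x : C2) : 2.-tuple V := [tuple delta_mx 0 i | i < 2].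

Lemma std_tnth x (i : 'I_2) : (std_frame x)`_i = delta_mx 0 i.
Proof. by rewrite -tnth_nth tnth_mktuple. Qed.

Lemma std_free x : free (std_frame x).
Proof.
apply/freeP => k; under eq_bigr do rewrite std_tnth.
move=> /rowP sum0 i; have := sum0 i; rewrite mxE summxE (bigD1 i)//= big1 => [|j ji].
  by rewrite !mxE !eqxx mulr1 addr0.
by rewrite !mxE /= eq_sym (negbTE ji) mulr0.
Qed.

Lemma std_basis x : basis_of fullv (std_frame x).
Proof. by rewrite basisEfree std_free subvf dimvf size_tuple. Qed.

Lemma coord_std x (i : 'I_2) (v : V) : coord (std_frame x) i v = v 0 i.
Proof.
rewrite {1}[v]row_sum_delta; under eq_bigr do rewrite -(std_tnth x).
by rewrite coord_sum_free// std_free.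
Qed.

(** Through the frame of images of the last two basis vectors every fiber is C^2, so the bundle is
    trivial and only its metric remembers the quotient. *)
Definition quotient_bundle : holBundle hermitian_C2 2.
Proof.
refine (@HolBundle R 2 hermitian_C2 2 (fun=> V) unit (fun=> setT) (fun=> std_frame)
  _ _ _ _).
- by move=> _; exact: openT.
- by move=> x; exists tt.
- by move=> _ x _; exact: std_basis.
- move=> _ _ a b i x _ _.
  exact: (@differentiable_cst C V C (coord (std_frame (0 : V)) a (tnth (std_frame (0 : V)) b))).
Defined.

Definition quotient_bundle_metric : hermitianMetric quotient_bundle.
Proof.
refine (@HermitianMetric R 2 hermitian_C2 2 quotient_bundle (@quotient_metric R) _).
move=> s a b i k; rewrite (_ : _ @` _ = setT); last by rewrite /= setIT image_id.
exact: (Ck_onT_qdot k (tnth (std_frame (0 : V)) a) (tnth (std_frame (0 : V)) b)).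
Defined.

Lemma gram_quotient (i : chart hermitian_C2) (s : trivialization quotient_bundle) :
  gram quotient_bundle_metric i s = @qgram R.
Proof.
by apply/funext => w; apply/matrixP => a b; rewrite !mxE !tnth_mktuple.
Qed.

Lemma quotient_not_Nakano : ~ Nakano_semipositive quotient_bundle_metric.
Proof.
(* The antisymmetric choice s_0 = e_1, s_1 = - e_0, at which the Nakano form at the origin equals
   -2. *)
pose v (j : 'I_2) : V := if j == 0 then delta_mx 0 1 else - delta_mx 0 0.
move=> /(_ tt tt (0 : V) Logic.I Logic.I v).
(* The curvature matrix at the origin has the single nonzero entry 1 at (k, j), so it sends u to u_k
   e_j. *)
have curvE j k (u : V) :
    @chern_curvature _ _ _ _ _ quotient_bundle_metric tt tt j k (0 : V) u =
    u 0 k *: delta_mx 0 j.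
  rewrite /chern_curvature /chern_curvature_mx gram_quotient.
  have Theta a b : (- dzbar_mx k
      (fun w => dz_mx j (@qgram R) w *m invmx (qgram w)) (0 : V)) a b =
      ((a == k) && (b == j))%:R by rewrite qcurvature mxE.
  rewrite (bigD1 k)//= [X in _ + X]big1 ?addr0 => [|a /negbTE ak]; last first.
    by apply: big1 => b _; rewrite [X in _ * X]Theta ak mulr0 scale0r.
  rewrite (bigD1 j)//= big1 ?addr0 => [|b /negbTE bj]; last first.
    by rewrite [X in _ * X]Theta bj andbF mulr0 scale0r.
  by rewrite [X in _ * X]Theta !eqxx mulr1 coord_std tnth_mktuple.
have hE j k (u w : V) :
    quotient_bundle_metric (0 : V) (u 0 k *: delta_mx 0 j) w =
    u 0 k * cconj (w 0 j).
  rewrite linearZl_LR; congr (_ * _).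
  rewrite -[LHS]/(qdot (0 : V) (delta_mx 0 j) w) /qdot /wedge /den !mxE.
  rewrite !(mul0r, mulr0, addr0) invr1 mulr1.
  by have [->|->] := ord2P j; rewrite /= ?(mul0r, mul1r, addr0, add0r).
under eq_bigr do under eq_bigr do rewrite curvE hE.
rewrite !(big_ord_recl, big_ord0) (_ : lift ord0 ord0 = 1); last exact: val_inj.
rewrite (_ : ord0 = 0); last exact: val_inj.
rewrite /v /= !mxE /= !(cconjE, oppr0, mulr0, mul0r, mul1r, mulN1r, mulr1, add0r, addr0).
rewrite lecE /= => /andP[_]; lra.
Qed.

Lemma differentiable_prod (I : Type) (s : seq I) (f : I -> V -> C) x :
  (forall i, differentiable (f i) x) ->
  differentiable (fun w => \prod_(i <- s) f i w) x.
Proof.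
move=> df; elim: s => [|i s IH].
  by under eq_fun do rewrite big_nil; exact: differentiable_cst.
by under eq_fun do rewrite big_cons; exact: differentiableM.
Qed.

Lemma quotient_weak_OT : weak_Ohsawa_Takegoshi quotient_bundle_metric.
Proof.
move=> x.
pose q (i : 'I_2) : (R * R) * (R * R) :=
  ((complex.Re ((x : V) 0 i) - 1, complex.Re ((x : V) 0 i) + 1),
   (complex.Im ((x : V) 0 i) - 1, complex.Im ((x : V) 0 i) + 1)).
exists (box q : set V); split; [exact: box_open|move=> i /=; split; lra|].
have boxfin : vol2 R (box q) \is a fin_num by rewrite ge0_fin_numE// vol2_box_lty.
(* Adding 1 makes the constant positive without a lower bound on the volume. *)
pose K := fine (vol2 R (box q)) + 1.
have K0 : 0 < K by rewrite ltr_pwDr// fine_ge0.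
exists (fun=> K); split=> //.
  rewrite -[X in _ --> X](mulr0 (ln K)).
  apply: cvgM; first exact: cvg_cst.
  (* The harmonic sequence is 1 / (m + 1), hence the shift past the index 0. *)
  by rewrite -cvg_shiftS; exact: cvg_harmonic.
move=> z Uz a a0 _ m m0.
exists (fun w => pure_power m (peak_section z a w : V)); split.
- move=> s J i w _ _.
  (* In the frame the coefficients of the tensor power are products of affine functions of [w]. *)
  rewrite (_ : _ \o _ = (fun w : V => \prod_k (a 0 (J k) +
      lift_coef z a * (z 0 (J k) - w 0 (J k))))).
    apply: differentiable_prod => k.
    apply: differentiableD; first exact: differentiable_cst.
    apply: differentiableM; first exact: differentiable_cst.
    apply: differentiableB; first exact: (@differentiable_cst C V C (z 0 (J k)) w).
    exact: (@differentiable_coord C 1 2 w 0 (J k)).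
  apply/funext => y /=; rewrite [LHS]tensor_coord_pure_power; apply: eq_bigr => k _.
  by rewrite [LHS]coord_std !mxE.
- by rewrite peak_sectionE.
rewrite tensor_norm2_pure_power.
under eq_integral do rewrite tensor_norm2_pure_power.
set M := norm2 _ a ^+ m.
have M0 : 0 <= M by rewrite exprn_ge0// norm2_ge0.
(* The integrand never exceeds its value [M] at [z], so the integral is at most vol(U) M, which is
   below K M. *)
apply: (@le_trans _ _ (\int[vol2 R]_(w in box q) (cst M%:E w))%E).
  apply: ge0_dominated_le_integral => w _; rewrite lee_fin.
    by rewrite exprn_ge0// norm2_ge0.
  by rewrite lerXn2r ?nnegrE ?norm2_ge0// peak_section_le.
have mbox : (@open V).-sigma.-measurable (box q).
  by apply: sub_sigma_algebra; exact: box_open.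
rewrite integral_cst//.
rewrite -[vol2 _ _](fineK boxfin) -EFinM lee_fin mulrC.
by rewrite ler_wpM2r// lerDl.
Qed.

End example.

Theorem theorem1p5 (R : realType) :
  exists (n : nat) (X : hermitianManifold R n) (r : nat) (E : holBundle X r)
    (h : hermitianMetric E),
    weak_Ohsawa_Takegoshi h /\ ~ Nakano_semipositive h.
Proof.
exists 2, (hermitian_C2 R), 2, (quotient_bundle R), (quotient_bundle_metric R).
by split; [exact: quotient_weak_OT|exact: quotient_not_Nakano].
Qed.
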